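(* Let $A,K,Q\in\mathbb{C}^{n\times n}$ with $K=K^*$ and $Q=Q^*$, and consider the complex continuous-time algebraic Riccati equation $A^*X+XA-XKX+Q=0$. Assume that the pair $(A,K)$ is stabilizable and the pair $(A,Q)$ is detectable. Let $\{X_k\}_{k\ge 0}$ be the Newton sequence for this equation, and let $A_k=KX_k-A$, $F(X_k)=X_kKX_k+Q$, so that $X_{k+1}$ is the solution of the Lyapunov equation $A_k^*X_{k+1}+X_{k+1}A_k=F(X_k)$. Let the parameters satisfy $\alpha_k>0$ and $0\le\omega_k<2$. Then, for every $k=0,1,\dots$, the sequence $\{X_{k+1,\ell}\}_{\ell=0}^{\infty}$ defined by $X_{k+1,0}=X_k$ and, for $\ell=0,1,\dots$, $$ \begin{cases} (\alpha_k I+A_k^* )\,X_{k+1,\ell+\frac12}=X_{k+1,\ell}\,(\alpha_k I-A_k)+F(X_k),\\ X_{k+1,\ell+1}\,(\alpha_k I+A_k)=X_{k+1,\ell}\,[A_k-(1-\omega_k)\alpha_k I]+(2-\omega_k)\alpha_k X_{k+1,\ell+\frac12}, \end{cases} $$ converges to $X_{k+1}$ as $\ell\to\infty$.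
   Context: Here $M^*$ denotes the conjugate transpose and $I$ the $n\times n$ identity matrix. The pair $(A,K)$ is called stabilizable if there exists $F\in\mathbb{C}^{n\times n}$ such that all eigenvalues of $A-KF$ lie in the open left half-plane; $(A,Q)$ is called detectable if $(A^*,Q^* )$ is stabilizable. Newton sequence: $X_0$ is a Hermitian matrix such that all eigenvalues of $A-KX_0$ lie in the open left half-plane, and $X_{k+1}$ is determined from $X_k$ by $(A-KX_k)^*X_{k+1}+X_{k+1}(A-KX_k)+X_kKX_k+Q=0$. Standing assumption along the Newton sequence: for every $k$, all eigenvalues of $A-KX_k$ lie in the open left half-plane; equivalently, all eigenvalues of $A_k=KX_k-A$ have positive real part. In particular the Lyapunov equation defining $X_{k+1}$ is uniquely solvable, and $\alpha_kI+A_k$ and $\alpha_kI+A_k^*$ are invertible for $\alpha_k>0$. *)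

(* Defs.v *)
From HB Require Import structures.
From mathcomp Require Import all_boot all_order all_algebra.
From mathcomp Require Import complex.
From mathcomp Require Import all_classical all_reals all_analysis.

Set Implicit Arguments.
Unset Strict Implicit.
Unset Printing Implicit Defensive.

Import Order.TTheory GRing.Theory Num.Theory.
Import numFieldNormedType.Exports.

Local Open Scope ring_scope.
Local Open Scope complex_scope.
Local Open Scope sesquilinear_scope.

(* MathComp-Analysis derives a topology from the norm of any abstract
   [numFieldType], but the concrete type [R[i]] does not inherit it by
   inference.  This instance makes 'M[R[i]]_n a topological space, with
   entrywise convergence for the modulus. *)
HB.instance Definition _ (R : rcfType) :=
  NormedModule.copy R[i] (R[i] : numFieldType).

Section Riccati.
Context {R : realType} {n : nat}.
Implicit Types A K Q X : 'M[R[i]]_n.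

Definition stable_mx (M : 'M[R[i]]_n) : Prop :=
  forall a : R[i], eigenvalue M a -> complex.Re a < 0.

(* [M ^t*] is the conjugate transpose. *)
Definition stabilizable A K : Prop :=
  exists F : 'M[R[i]]_n, stable_mx (A - K *m F).

Definition detectable A Q : Prop := stabilizable (A ^t*) (Q ^t*).

Definition newton_sequence A K Q (X : nat -> 'M[R[i]]_n) : Prop :=
  [/\ X 0%N = (X 0%N) ^t*,
      stable_mx (A - K *m X 0%N)
    & forall k, (A - K *m X k) ^t* *m X k.+1 + X k.+1 *m (A - K *m X k)
                + X k *m K *m X k + Q = 0].

Definition lyap_coef A K X : 'M[R[i]]_n := K *m X - A.

Definition lyap_rhs K Q X : 'M[R[i]]_n := X *m K *m X + Q.

(* The iterates X_(k+1,l) and X_(k+1,l+1/2) are [Y l] and [Yhalf l], with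
   Ak and Fk standing for A_k and F(X_k). *)
Definition inner_iteration (alpha omega : R) (Ak Fk Xk : 'M[R[i]]_n)
    (Y Yhalf : nat -> 'M[R[i]]_n) : Prop :=
  [/\ Y 0%N = Xk,
      forall l, (alpha%:C%:M + Ak ^t*) *m Yhalf l
                = Y l *m (alpha%:C%:M - Ak) + Fk
    & forall l, Y l.+1 *m (alpha%:C%:M + Ak)
                = Y l *m (Ak - ((1 - omega) * alpha)%:C%:M)
                  + ((2 - omega) * alpha)%:C *: Yhalf l].

End Riccati.

(* Main.v *)
Require Import Defs.
From HB Require Import structures.
From mathcomp Require Import all_boot all_order all_algebra.
From mathcomp Require Import complex.
From mathcomp Require Import all_classical all_reals all_analysis.
From mathcomp Require Import ring.
Import Order.TTheory GRing.Theory Num.Theory.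
Import numFieldNormedType.Exports.
Local Open Scope classical_set_scope.
Local Open Scope ring_scope.
Local Open Scope complex_scope.
Local Open Scope sesquilinear_scope.

(** Why the inner iteration converges.  Put [B = K X_k - A], whose eigenvalues
    have positive real part; with [S = alpha I + B], let
    [M = (alpha I - B) S^-1] be its Cayley transform, and let
    [E_l = X_(k+1,l) - X_(k+1)].  As [X_(k+1)] solves [B^* X + X B = F], it is a
    fixed point of both half steps, so the errors satisfy the homogeneous
    recursion.  Eliminating the half step from it ([cayley_relaxed_stein]) gives
      [E_(l+1) = theta E_l + (1 - theta) M^* E_l M],  [theta = omega / 2],
    a convex combination of the identity and of the Stein map [E |-> M^* E M].
    The number [theta] runs over [[0, 1)] exactly when [omega] runs over
    [[0, 2)].

    The map [z |-> (alpha - z) / (alpha + z)] sends the open right half-plane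
    into the open unit disc, hence all eigenvalues of [M] have modulus less than
    1 ([cayley_eigenvalue_lt1]).  In a suitable basis [M] then becomes a matrix
    [D] whose columns all have absolute sum at most some [q < 1]
    ([contracting_similarity]).  In that basis [E |-> D^* E D] shrinks the
    largest modulus of an entry by the factor [q ^ 2], so the averaged map
    shrinks it by [theta + (1 - theta) q ^ 2 < 1], and the errors decay
    geometrically ([relaxed_stein_geometric]). *)

(** * A similarity that makes a matrix of spectral radius below 1 a contraction *)

Lemma trmxC_mul {C : numClosedFieldType} {m n p : nat}
    (A : 'M[C]_(m, n)) (B : 'M[C]_(n, p)) :
  (A *m B) ^t* = B ^t* *m A ^t*.
Proof. by rewrite trmx_mul map_mxM. Qed.

(** The order of a [numFieldType] is only partial, so a minimum of the family
    is not at hand; the inverse of [1] plus the sum of the inverses serves. *)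
Lemma finite_pos_lower_bound {F : numFieldType} {I : finType} (x : I -> F) :
  (forall i, 0 < x i) -> exists2 e, 0 < e & forall i, e <= x i.
Proof.
move=> x_gt0; pose s := 1 + \sum_i (x i)^-1.
have xV_ge0 i : 0 <= (x i)^-1 by rewrite invr_ge0 ltW.
have s_gt0 : 0 < s by rewrite ltr_wpDr ?ltr01 ?sumr_ge0.
exists s^-1 => [|i]; first by rewrite invr_gt0.
rewrite -[x i]invrK lef_pV2 ?posrE ?invr_gt0 // /s (bigD1 i) //= addrCA.
by rewrite lerDl addr_ge0 ?ler01 ?sumr_ge0.
Qed.

Lemma trig_diag_eigenvalue {F : fieldType} {n : nat} {D : 'M[F]_n} (i : 'I_n) :
  is_trig_mx D -> eigenvalue D (D i i).
Proof.
move=> D_trig; rewrite eigenvalue_root_char char_poly_trig // /root horner_prod.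
by rewrite (bigD1 i) //= !hornerE subrr mul0r.
Qed.

(** Schur's theorem makes [M] lower triangular, with its eigenvalues on the
    diagonal; conjugating by [diag (1, d, d^2, ...)] then multiplies each entry
    [(i, j)] below the diagonal by [d ^ (i - j)].  For small [d] the column sums
    are as close to the moduli of the eigenvalues as desired. *)
Lemma contracting_similarity {C : numClosedFieldType} {n : nat} (M : 'M[C]_n) :
  (forall a, eigenvalue M a -> `|a| < 1) ->
  exists P D : 'M[C]_n, exists2 q : C, 0 <= q < 1 &
    [/\ P \in unitmx, P *m M = D *m P & forall j, \sum_i `|D i j| <= q].
Proof.
case: n M => [|n] M Mlt1.
  exists 1%:M, M, 0; first by rewrite lexx ltr01.
  by split=> [||[]//]; rewrite ?unitmx1 ?mulmx1 ?mul1mx.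
have [U U_unitary U_trig] := Schur M isT.
have [T UM T_trig] : exists2 T, U *m M = T *m U & is_trig_mx T.
  exists (conjmx U M) => //; rewrite conjymx // -!mulmxA -invmx_unitary //.
  by rewrite mulVmx ?mulmx1 ?unitarymx_unit.
have Tlt1 i : `|T i i| < 1.
  apply: Mlt1; have /eigenvalueP[v vT v_neq0] :=
    trig_diag_eigenvalue i T_trig.
  apply/eigenvalueP; exists (v *m U).
    by rewrite -mulmxA UM mulmxA vT scalemxAl.
  apply: contra_neq v_neq0 => vU0.
  by rewrite -[v](mulmxK (unitarymx_unit U_unitary)) vU0 mul0mx.
(* The number [e] serves twice: as the budget of each column for its scaled
   entries below the diagonal, and as the margin by which the column sums stay
   below 1. *)
pose gap i := (1 - `|T i i|) / 2%:R.
have gap_gt0 i : 0 < gap i by rewrite divr_gt0 ?subr_gt0 ?ltr0Sn.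
have [e e_gt0 e_le] := finite_pos_lower_bound gap gap_gt0.
have T_le i : `|T i i| + e <= 1 - e.
  have := e_le i; rewrite ler_pdivlMr ?ltr0Sn // -[_ <= 1 - _]subr_ge0.
  by rewrite -[_ + e <= _]subr_ge0; congr (0 <= _); ring.
have sum_ge0 j : 0 <= \sum_i `|T i j| by rewrite sumr_ge0.
have q_ge0 : 0 <= 1 - e.
  by apply: le_trans (T_le ord0); rewrite addr_ge0 // ltW.
have [d [d_gt0 d_le1 col_le]] : exists d : C,
    [/\ 0 < d, d <= 1 & forall j, d * (\sum_i `|T i j|) <= e].
  pose s := 1 + \sum_j \sum_i `|T i j|.
  have s_ge1 : 1 <= s by rewrite lerDl sumr_ge0.
  have s_gt0 : 0 < s := lt_le_trans ltr01 s_ge1.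
  exists (e / s); split=> [||j]; first by rewrite divr_gt0.
    by rewrite ler_pdivrMr // mul1r (le_trans _ s_ge1) // -subr_ge0.
  rewrite mulrAC ler_pdivrMr // ler_wpM2l ?(ltW e_gt0) //.
  by rewrite /s [X in 1 + X](bigD1 j) //= addrCA lerDl addr_ge0 ?sumr_ge0.
have d_ge0 := ltW d_gt0.
pose D := \matrix_(i, j) (d ^+ i * T i j / d ^+ j).
pose S : 'M[C]_n.+1 := diag_mx (\row_i d ^+ i).
have d_neq0 k : d ^+ k != 0 by rewrite expf_neq0 ?gt_eqF.
exists (S *m U), D, (1 - e); first by rewrite q_ge0 gtrBl.
split=> [||j].
- rewrite unitmx_mul (unitarymx_unit U_unitary) andbT.
  rewrite unitmxE det_diag unitfE; apply/prodf_neq0 => i _.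
  by rewrite mxE.
- rewrite -mulmxA UM !mulmxA; congr (_ *m _).
  by apply/matrixP => i j; rewrite mul_diag_mx mul_mx_diag !mxE divfK.
apply: le_trans (T_le j); rewrite (bigD1 j) //= mxE mulrAC divff // mul1r.
rewrite lerD2l; apply: le_trans (col_le j).
rewrite mulr_sumr [leRHS](bigD1 j) //= ler_wpDl ?mulr_ge0 //.
apply: ler_sum => i i_neqj; rewrite mxE.
have [lt_ij|lt_ji|/val_inj eq_ij] := ltngtP i j.
- by rewrite (is_trig_mxP T_trig) // mulr0 mul0r normr0 mulr0.
- rewrite mulrAC -expfB // normrM ler_wpM2r // ger0_norm ?exprn_ge0 //.
  by rewrite -(subnSK lt_ji) exprS ger_pMr // exprn_ile1.
- by rewrite eq_ij eqxx in i_neqj.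
Qed.

(** * Geometric decay of the relaxed Stein iteration *)

Lemma sum_mulmx2 {C : numDomainType} {m n p r : nat} (A : 'M[C]_(m, n))
    (E : 'M[C]_(n, p)) (B : 'M[C]_(p, r)) (i : 'I_m) (j : 'I_r) :
  (A *m E *m B) i j = \sum_l \sum_k A i k * E k l * B l j.
Proof.
by rewrite !mxE; apply: eq_bigr => l _; rewrite mxE mulr_suml.
Qed.

Lemma norm_sandwich_le {C : numDomainType} {m n p r : nat} (A : 'M[C]_(m, n))
    (E : 'M[C]_(n, p)) (B : 'M[C]_(p, r)) (b : C) (i : 'I_m) (j : 'I_r) :
  (forall k l, `|E k l| <= b) ->
  `|(A *m E *m B) i j| <= (\sum_k `|A i k|) * (\sum_l `|B l j|) * b.
Proof.
move=> E_le; rewrite sum_mulmx2 mulr_sumr mulr_suml.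
apply: (le_trans (ler_norm_sum _ _ _)); apply: ler_sum => l _.
rewrite !mulr_suml.
apply: (le_trans (ler_norm_sum _ _ _)); apply: ler_sum => k _.
by rewrite !normrM mulrAC ler_wpM2l ?mulr_ge0.
Qed.

(** In the basis [P] of [contracting_similarity] the iterate [E l] becomes
    [G l], which obeys the same recursion with [D] in place of [M]; the largest
    modulus of its entries contracts by [theta + (1 - theta) q ^ 2]. *)
Lemma relaxed_stein_geometric {C : numClosedFieldType} {n : nat}
    (M : 'M[C]_n) (theta : C) (E : nat -> 'M[C]_n) :
  (forall a, eigenvalue M a -> `|a| < 1) -> 0 <= theta < 1 ->
  (forall l, E l.+1 = theta *: E l + (1 - theta) *: (M ^t* *m E l *m M)) ->
  exists b r : C,
    [/\ 0 <= b, 0 <= r < 1 & forall l i j, `|E l i j| <= b * r ^+ l].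
Proof.
move=> Mlt1 /andP[theta_ge0 theta_lt1] E_rec.
have [P [D [q /andP[q_ge0 q_lt1] [P_unit PM D_le]]]] :=
  contracting_similarity _ Mlt1.
pose G l := (invmx P) ^t* *m E l *m invmx P.
have MP : M *m invmx P = invmx P *m D.
  by rewrite -[LHS](mulKmx P_unit) [P *m (M *m _)]mulmxA PM mulmxK.
have G_rec l : G l.+1 = theta *: G l + (1 - theta) *: (D ^t* *m G l *m D).
  rewrite /G E_rec mulmxDr mulmxDl -!scalemxAr -!scalemxAl.
  congr (_ + _ *: _); rewrite !mulmxA -!trmxC_mul MP.
  by rewrite -!mulmxA MP.
have EG l : E l = P ^t* *m G l *m P.
  rewrite /G !mulmxA -trmxC_mul mulVmx // -mulmxA mulVmx // mulmx1.
  by rewrite trmx1 map_mx1 mul1mx.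
pose b0 := \sum_i \sum_j `|G 0%N i j|.
pose r := theta + (1 - theta) * (q * q).
have theta'_ge0 : 0 <= 1 - theta by rewrite subr_ge0 ltW.
have r_ge0 : 0 <= r by rewrite addr_ge0 ?mulr_ge0.
have r_lt1 : r < 1.
  by rewrite /r -ltrBrDl gtr_pMr ?subr_gt0 // mulr_ilt1.
have G_le l i j : `|G l i j| <= b0 * r ^+ l.
  elim: l i j => [|l IHl] i j.
    rewrite expr0 mulr1 /b0 (bigD1 i) //= (bigD1 j) //= -addrA lerDl.
    by rewrite addr_ge0 ?sumr_ge0 // => k _; rewrite sumr_ge0.
  have b_ge0 : 0 <= b0 * r ^+ l by exact: le_trans (normr_ge0 _) (IHl i j).
  rewrite G_rec mxE [X in `|X + _|]mxE [X in `|_ + X|]mxE.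
  apply: le_trans (ler_normD _ _) _; rewrite !normrM.
  rewrite (ger0_norm theta_ge0) (ger0_norm theta'_ge0).
  rewrite exprS mulrCA {1}/r [leRHS]mulrDl.
  apply: lerD; first by rewrite ler_wpM2l.
  rewrite -mulrA ler_wpM2l //.
  apply: le_trans (norm_sandwich_le _ _ _ _ i j IHl) _.
  rewrite ler_wpM2r // ler_pM ?sumr_ge0 //.
  apply: le_trans (D_le i); apply: ler_sum => k _.
  by rewrite !mxE norm_conjC.
exists ((\sum_i \sum_k `|P ^t* i k|) * (\sum_j \sum_k `|P k j|) * b0), r.
have sum2_ge0 (F : 'I_n -> 'I_n -> C) : 0 <= \sum_i \sum_j `|F i j|.
  by apply: sumr_ge0 => i _; rewrite sumr_ge0.
split=> [||l i j]; [by rewrite !mulr_ge0 ?sum2_ge0 | by rewrite r_ge0 |].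
rewrite EG; apply: le_trans (norm_sandwich_le _ _ _ _ i j (G_le l)) _.
have b_ge0 : 0 <= b0 * r ^+ l by exact: le_trans (normr_ge0 _) (G_le l i j).
rewrite -[leRHS]mulrA ler_wpM2r // ler_pM ?sumr_ge0 //.
  by rewrite [leRHS](bigD1 i) //= lerDl sumr_ge0 // => k _; rewrite sumr_ge0.
by rewrite [leRHS](bigD1 j) //= lerDl sumr_ge0 // => k _; rewrite sumr_ge0.
Qed.

(** * The Cayley transform of a matrix with spectrum in the right half-plane *)

Lemma norm_sub_lt_norm_add {C : numClosedFieldType} (alpha mu : C) :
  0 < alpha -> 0 < 'Re mu -> `|alpha - mu| < `|alpha + mu|.
Proof.
move=> alpha_gt0 mu_gt0.
rewrite -(@ltr_pXn2r _ 2) ?nnegrE // !normCK !rmorphD !rmorphN /=.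
rewrite (CrealP (gtr0_real alpha_gt0)) -subr_gt0.
have -> : (alpha + mu) * (alpha + mu^*) - (alpha - mu) * (alpha - mu^*)
  = 4%:R * (alpha * 'Re mu).
  by rewrite ReE; field.
by rewrite !mulr_gt0 ?ltr0Sn.
Qed.

Lemma shift_unitmx {C : numClosedFieldType} {n : nat} (alpha : C)
    (B : 'M[C]_n) :
  0 < alpha -> (forall a, eigenvalue B a -> 0 < 'Re a) ->
  alpha%:M + B \in unitmx.
Proof.
move=> alpha_gt0 B_pos.
rewrite -row_free_unit -kermx_eq0; apply/rowV0P => v /sub_kermxP.
rewrite mulmxDr mul_mx_scalar => /eqP.
rewrite addrC addr_eq0 -scaleNr => /eqP vB.
apply/eqP; apply: contraT => v_neq0.
have /B_pos : eigenvalue B (- alpha) by apply/eigenvalueP; exists v.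
rewrite raddfN /= (Creal_ReP _ (gtr0_real alpha_gt0)) oppr_gt0.
by rewrite (lt_gtF alpha_gt0).
Qed.

(** An eigenvector of the Cayley transform for [c] is an eigenvector of [B]
    for [mu = alpha (1 - c) / (1 + c)], that is [c = (alpha - mu) / (alpha + mu)],
    and [mu] is closer to [alpha] than to [- alpha]. *)
Lemma cayley_eigenvalue_lt1 {C : numClosedFieldType} {n : nat} (alpha : C)
    (B : 'M[C]_n) (c : C) :
  0 < alpha -> (forall a, eigenvalue B a -> 0 < 'Re a) ->
  eigenvalue ((alpha%:M - B) *m invmx (alpha%:M + B)) c -> `|c| < 1.
Proof.
move=> alpha_gt0 B_pos /eigenvalueP[v vC v_neq0].
have {}vC : v *m (alpha%:M - B) = c *: (v *m (alpha%:M + B)).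
  by rewrite scalemxAl -vC mulmxA mulmxKV ?shift_unitmx.
have vB : (1 + c) *: (v *m B) = (alpha * (1 - c)) *: v.
  move: vC; rewrite mulmxBr mulmxDr mul_mx_scalar => /matrixP vC.
  apply/matrixP => i j; move: (vC i j).
  rewrite !mxE; set x := \sum_k _; move=> eq_x.
  apply/eqP; rewrite -subr_eq0; apply/eqP.
  transitivity (c * (alpha * v i j + x) - (alpha * v i j - x)); first by ring.
  by rewrite -eq_x subrr.
(* If [c = -1], the previous equation reads [0 = 2 alpha v]. *)
have c_neqN1 : 1 + c != 0.
  apply: contra_neq v_neq0 => c1; move: vB; rewrite c1 scale0r => /esym/eqP.
  rewrite scalemx_eq0 mulf_eq0 gt_eqF //= => /orP[/eqP c1'|/eqP //].
  have : (1 + c) + (1 - c) = 0 by rewrite c1 c1' addr0.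
  by rewrite addrACA subrr addr0 => /eqP; rewrite -mulr2n pnatr_eq0.
pose mu := alpha * (1 - c) / (1 + c).
have mu_pos : 0 < 'Re mu.
  apply: B_pos; apply/eigenvalueP; exists v => //; apply: (scalerI c_neqN1).
  by rewrite vB scalerA; congr (_ *: _); rewrite /mu; field.
have := norm_sub_lt_norm_add _ _ alpha_gt0 mu_pos.
have -> : alpha - mu = c * (alpha + mu) by rewrite /mu; field.
rewrite normrM gtr_pMl // lt_def normr_ge0 andbT normr_eq0.
have -> : alpha + mu = 2%:R * alpha / (1 + c) by rewrite /mu; field.
by rewrite !mulf_neq0 ?invr_eq0 ?pnatr_eq0 // gt_eqF.
Qed.

(** Here [E], [H] and [E'] are the errors of one iterate, of its half step and
    of the next iterate.  With [S = alpha I + B], both sides agree once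
    multiplied by [S^*] on the left and by [S] on the right: they become the
    same combination of [E], [B^* E], [E B] and [B^* E B]. *)
Lemma cayley_relaxed_stein {C : numClosedFieldType} {n : nat} (alpha : C)
    (B : 'M[C]_n)
    (omega : C) (E E' H : 'M[C]_n) :
  0 < alpha -> (forall a, eigenvalue B a -> 0 < 'Re a) ->
  (alpha%:M + B ^t*) *m H = E *m (alpha%:M - B) ->
  E' *m (alpha%:M + B)
    = E *m (B - ((1 - omega) * alpha)%:M) + ((2%:R - omega) * alpha) *: H ->
  let M := (alpha%:M - B) *m invmx (alpha%:M + B) in
  E' = (omega / 2%:R) *: E + (1 - omega / 2%:R) *: (M ^t* *m E *m M).
Proof.
move=> alpha_gt0 B_pos H_eq E'_eq M.
have S_unit := shift_unitmx alpha B alpha_gt0 B_pos.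
set S := alpha%:M + B in S_unit E'_eq M *.
have SC : S ^t* = alpha%:M + B ^t*.
  rewrite linearD /= map_mxD tr_scalar_mx map_scalar_mx /=.
  by rewrite (CrealP (gtr0_real alpha_gt0)).
have SC_unit : S ^t* \in unitmx by rewrite map_unitmx unitmx_tr.
have MS : M *m S = alpha%:M - B by rewrite mulmxKV.
have SM : S ^t* *m M ^t* = alpha%:M - B ^t*.
  rewrite -trmxC_mul MS linearB /= map_mxB tr_scalar_mx map_scalar_mx /=.
  by rewrite (CrealP (gtr0_real alpha_gt0)).
apply: (can_inj (mulmxK S_unit)); apply: (can_inj (mulKmx SC_unit)).
rewrite E'_eq.
have -> : S ^t* *m (((omega / 2%:R) *: E
    + (1 - omega / 2%:R) *: (M ^t* *m E *m M)) *m S)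
  = (omega / 2%:R) *: (S ^t* *m E *m S)
    + (1 - omega / 2%:R) *: ((alpha%:M - B ^t*) *m E *m (alpha%:M - B)).
  by rewrite mulmxDl mulmxDr -!scalemxAl -!scalemxAr -SM -MS !mulmxA.
rewrite mulmxDr -scalemxAr SC H_eq /S.
rewrite !(mulmxDl, mulmxDr, mulNmx, mulmxN, mul_scalar_mx, mul_mx_scalar).
rewrite -?scalemxAl -?scalemxAr ?mulmxA.
move: (B ^t* *m E) (E *m B) (B ^t* *m E *m B) => BE EB BEB.
by apply/matrixP => i j; rewrite !mxE; field.
Qed.

(** * Convergence of the inner iteration *)

(** The bounds [b] and [r] are nonnegative, hence real, complex numbers; passing
    to their real parts reduces the claim to a real geometric sequence. *)
Lemma cvg_mx_geometric {R : realType} {m n : nat} (Y : nat -> 'M[R[i]]_(m, n))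
    (X : 'M[R[i]]_(m, n)) (b r : R[i]) :
  0 <= b -> 0 <= r < 1 ->
  (forall l i j, `|(Y l - X) i j| <= b * r ^+ l) -> Y l @[l --> \oo] --> X.
Proof.
move=> b_ge0 /andP[r_ge0 r_lt1] Y_le.
have realE (z : R[i]) : 0 <= z -> z = (complex.Re z)%:C.
  by move=> /ger0_real/RRe_real.
apply/cvg_ballP => eps eps_gt0.
have : `|complex.Re r| < 1.
  by rewrite ger0_norm -?ltcR -?lecR -realE.
move=> /(cvg_geometric (complex.Re b))/cvgrPdist_lt/(_ (complex.Re eps)).
rewrite -ltcR -realE ?ltW // => /(_ eps_gt0).
apply: filterS => l; rewrite sub0r normrN /= => lt_eps; split=> // i j.
rewrite /ball /= distrC.
have := Y_le l i j; rewrite !mxE => /le_lt_trans; apply.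
rewrite (realE _ b_ge0) (realE _ r_ge0) -rmorphXn -rmorphM /=.
rewrite (realE eps) ?ltW // ltcR; apply: le_lt_trans lt_eps.
exact: ler_norm.
Qed.

Theorem theorem2p6 (R : realType) (n : nat) (A K Q : 'M[R[i]]_n)
    (X : nat -> 'M[R[i]]_n) (alpha omega : nat -> R)
    (hK : K = K ^t*) (hQ : Q = Q ^t*)
    (hstab : stabilizable A K) (hdet : detectable A Q)
    (hX : newton_sequence A K Q X)
    (hXstable : forall k : nat, stable_mx (A - K *m X k))
    (halpha : forall k : nat, 0 < alpha k)
    (homega : forall k : nat, 0 <= omega k < 2) :
  forall (k : nat) (Y Yhalf : nat -> 'M[R[i]]_n),
    inner_iteration (alpha k) (omega k)
      (lyap_coef A K (X k)) (lyap_rhs K Q (X k)) (X k) Y Yhalf ->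
    Y l @[l --> \oo] --> X k.+1.
Proof.
move=> k Y Yhalf [_ half_eq full_eq].
have [_ _ /(_ k) newton_eq] := hX.
pose B := lyap_coef A K (X k).
have lyap_eq : B ^t* *m X k.+1 + X k.+1 *m B = lyap_rhs K Q (X k).
  have AK : A - K *m X k = - B by rewrite opprB.
  move: newton_eq; rewrite AK linearN /= map_mxN mulNmx mulmxN -addrA -opprD.
  by move/eqP; rewrite addrC subr_eq0 => /eqP.
have B_pos a : eigenvalue B a -> 0 < 'Re a.
  move=> /eigenvalueP[v vB v_neq0].
  have /(hXstable k) : eigenvalue (A - K *m X k) (- a).
    by apply/eigenvalueP; exists v; rewrite // -opprB mulmxN vB scaleNr.
  by rewrite -complexRe raddfN /= oppr_lt0 -ltcR.
have alpha_gt0 : 0 < (alpha k)%:C :> R[i] by rewrite ltcR.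
pose M := ((alpha k)%:C%:M - B) *m invmx ((alpha k)%:C%:M + B).
(* The stationary equation [lyap_eq] turns the affine steps into the
   homogeneous recursion for the errors. *)
have [||l|b [r [b_ge0 r_lt1 E_le]]] :=
  relaxed_stein_geometric M ((omega k)%:C / 2%:R) (fun l => Y l - X k.+1).
- by move=> c; exact: cayley_eigenvalue_lt1.
- have /andP[omega_ge0 omega_lt2] := homega k.
  rewrite divr_ge0 ?ler0n ?lecR //= ltr_pdivrMr ?ltr0Sn // mul1r.
  by rewrite -(rmorph_nat (real_complex R)) ltcR.
- apply: (cayley_relaxed_stein _ _ _ _ _ (Yhalf l - X k.+1) alpha_gt0 B_pos).
    rewrite mulmxBr half_eq -/B -lyap_eq.
    rewrite !(mulmxDl, mulmxDr, mulNmx, mulmxN, mul_scalar_mx, mul_mx_scalar).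
    by apply/matrixP => i j; rewrite !mxE; ring.
  have -> : (1 - (omega k)%:C) * (alpha k)%:C = ((1 - omega k) * alpha k)%:C.
    by rewrite rmorphM rmorphB.
  have -> : (2%:R - (omega k)%:C) * (alpha k)%:C
      = ((2 - omega k) * alpha k)%:C.
    by rewrite rmorphM rmorphB rmorph_nat.
  rewrite mulmxBl full_eq -/B.
  rewrite !(mulmxDl, mulmxDr, mulNmx, mulmxN, mul_scalar_mx, mul_mx_scalar).
  by apply/matrixP => i j; rewrite !mxE; ring.
exact: cvg_mx_geometric E_le.
Qed.
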